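(* Let $G$ be a group, and let $\mathrm{Conj}(G)$ denote the conjugation quandle of $G$. Then the following statements hold: (1) The Cayley graph $\Gamma_{\mathrm{Conj}(G)}$ is symmetric. (2) The connected components of $\Gamma_{\mathrm{Conj}(G)}$ are complete subgraphs induced by the conjugacy classes of $G$.
   Context: A quandle is a set $Q$ with a binary operation $\rhd$ such that for all $x,y,z\in Q$: (1) $x\rhd x=x$; (2) for each $y$ the map $R_y(x)=x\rhd y$ is a bijection $Q\to Q$; (3) $(x\rhd y)\rhd z=(x\rhd z)\rhd(y\rhd z)$. The conjugation quandle $\mathrm{Conj}(G)$ of a group $G$ is the set $G$ with operation $x\rhd y=y^{-1}xy$. All graphs are directed graphs, with loops allowed and without multiple edges, so the edge set is a subset of $V\times V$. The (right) Cayley graph $\Gamma_Q$ of a quandle $Q$ is the directed graph with vertex set $Q$ and edge set $\{(x,x\rhd y): x,y\in Q\}$. A directed graph is symmetric if whenever $(a,c)$ is an edge, so is $(c,a)$. It is connected if for every ordered pair of vertices $(u,v)$ there is a directed path from $u$ to $v$; the connected components are the maximal connected induced subgraphs. A directed graph is complete if for any two distinct vertices $a,b$ both edges $(a,b)$ and $(b,a)$ are present and there is exactly one loop at each vertex. *)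

(* Defs.v *)
From HB Require Import structures.
From Stdlib Require Import Relation_Operators.
From mathcomp Require Import all_boot.
From mathcomp Require Import boolp classical_sets.

Set Implicit Arguments.
Unset Strict Implicit.
Unset Printing Implicit Defensive.

Local Open Scope group_scope.
Local Open Scope classical_set_scope.

Reserved Notation "x |> y" (at level 40, no associativity).

HB.mixin Record isQuandle Q := {
  rhd : Q -> Q -> Q;
  rhdxx : forall x, rhd x x = x;
  rhd_bij : forall y, bijective (fun x => rhd x y);
  rhd_distr : forall x y z, rhd (rhd x y) z = rhd (rhd x z) (rhd y z)
}.

#[short(type="quandleType")]
HB.structure Definition Quandle := { Q of isQuandle Q }.

Notation "x |> y" := (rhd x y).

(* An alias of [G], so that the quandle structure is not attached to [G]
   itself. *)
Definition Conj (G : groupType) : Type := G.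

Section ConjQuandle.
Variable G : groupType.

Definition conj_rhd (x y : Conj G) : Conj G := (y : G)^-1 * (x : G) * (y : G).

Lemma conj_rhdE (x y : G) : conj_rhd x y = x ^ y.
Proof. by rewrite /conj_rhd conjgE mulgA. Qed.

Lemma conj_rhdxx x : conj_rhd x x = x.
Proof. by rewrite /conj_rhd mulVg mul1g. Qed.

Lemma conj_rhd_bij y : bijective (fun x => conj_rhd x y).
Proof.
exists (fun x => conj_rhd x (y : G)^-1) => x; rewrite !conj_rhdE.
  exact: conjgK.
exact: conjgKV.
Qed.

Lemma conj_rhd_distr x y z :
  conj_rhd (conj_rhd x y) z = conj_rhd (conj_rhd x z) (conj_rhd y z).
Proof. by rewrite !conj_rhdE; exact: conjJg. Qed.

HB.instance Definition _ :=
  isQuandle.Build (Conj G) conj_rhdxx conj_rhd_bij conj_rhd_distr.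

End ConjQuandle.

Record digraph := Digraph {
  vertex :> Type;
  edges : set (vertex * vertex)
}.

Definition cayley_graph (Q : quandleType) : digraph :=
  @Digraph Q [set (x, x |> y) | x in [set: Q] & y in [set: Q]].

Definition symmetric_digraph (D : digraph) : Prop :=
  forall a c : D, edges (a, c) -> edges (c, a).

(* The path of length 0 from a vertex to itself is allowed. *)
Definition dipath (D : digraph) (u v : D) : Prop :=
  clos_refl_trans D (fun a b => edges (a, b)) u v.

Definition connected_digraph (D : digraph) : Prop :=
  forall u v : D, dipath u v.

Definition induced (D : digraph) (A : set D) : digraph :=
  @Digraph A [set e | edges (\val e.1, \val e.2)].

(* An induced subgraph is represented by its vertex set: for induced subgraphs,
   inclusion of subgraphs is inclusion of vertex sets. *)
Definition connected_component (D : digraph) (A : set D) : Prop :=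
  connected_digraph (induced A) /\
  forall B : set D, A `<=` B -> connected_digraph (induced B) -> B = A.

(* The edges form a set of pairs, so there is at most one loop at each vertex
   and "exactly one loop" means that the loop is present. *)
Definition complete_digraph (D : digraph) : Prop :=
  (forall a b : D, a <> b -> edges (a, b) /\ edges (b, a)) /\
  (forall a : D, edges (a, a)).

Definition conjugacy_class (G : groupType) (x : G) : set G :=
  [set x ^ g | g in [set: G]].

(* Main.v *)
(* Edges of the Cayley graph of Conj(G) join conjugate elements, and conjugacy
   is an equivalence relation. Hence directed paths stay inside a conjugacy
   class, while each class induces a complete, thus connected, subgraph: the
   classes are the maximal connected induced subgraphs. *)
Require Import Defs.
From mathcomp Require Import all_boot.
From mathcomp Require Import boolp classical_sets.
From Stdlib Require Import Relation_Operators.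

Local Open Scope classical_set_scope.

Section ConjugacyClass.
Variable G : groupType.
Implicit Types x y z : G.

Lemma conjugacy_class_refl x : conjugacy_class x x.
Proof. by exists 1%g; rewrite ?conjg1. Qed.

Lemma conjugacy_class_sym x y : conjugacy_class x y -> conjugacy_class y x.
Proof. by move=> [g _ <-]; exists (g^-1)%g; rewrite ?conjgK. Qed.

Lemma conjugacy_class_trans x y z :
  conjugacy_class x y -> conjugacy_class y z -> conjugacy_class x z.
Proof. by move=> [g _ <-] [h _ <-]; exists (g * h)%g; rewrite ?conjgM. Qed.

End ConjugacyClass.

Lemma complete_connected (D : digraph) : complete_digraph D -> connected_digraph D.
Proof.
move=> [cD _] u v; have [->|uv] := pselect (u = v); first exact: rt_refl.
by apply: rt_step; case: (cD _ _ uv).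
Qed.

Section ConjCayley.
Variable G : groupType.
Local Notation Gamma := (cayley_graph (Conj G)).
Implicit Types (x : G) (A : set Gamma).

(** The right operand of [|>] is the conjugating element, so the out-neighbours of [a] are exactly
    the elements [a ^ g]. *)
Lemma cayley_conj_edgeP (a b : Gamma) :
  edges (a, b) <-> conjugacy_class (a : G) (b : G).
Proof.
split=> [[x _ [y _ [<- <-]]]|[g _ <-]].
  by exists y => //; rewrite -conj_rhdE.
by exists a => //; exists g => //; congr pair; exact: conj_rhdE.
Qed.

(** Induction on the path: every edge is a conjugation, and conjugacy is reflexive and
    transitive. *)
Lemma dipath_conjugacy_class A (u v : induced A) :
  dipath u v -> conjugacy_class (\val u : G) (\val v : G).
Proof.
elim=> {u v} [u v /cayley_conj_edgeP//|u|u v w _ uv _ vw].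
- exact: conjugacy_class_refl.
- exact: conjugacy_class_trans uv vw.
Qed.

Lemma connected_sub_conjugacy_class A x :
  connected_digraph (induced A) -> A x -> A `<=` conjugacy_class x.
Proof.
move=> cA Ax y Ay.
by have := dipath_conjugacy_class _ _ _
  (cA (SigSub (mem_set Ax)) (SigSub (mem_set Ay))).
Qed.

Lemma complete_conjugacy_class x :
  complete_digraph (induced (conjugacy_class x : set Gamma)).
Proof.
(* Both vertices are conjugate to [x], hence to each other. The case [a = b] is included, which
   supplies the loops. *)
have edge (a b : induced (conjugacy_class x : set Gamma)) : edges (a, b).
  apply/cayley_conj_edgeP; apply: (@conjugacy_class_trans _ _ x).
    by apply: conjugacy_class_sym; exact: set_mem (valP a).
  exact: set_mem (valP b).
by split.
Qed.

Lemma connected_component_conj A :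
  connected_component A <-> exists x, A = conjugacy_class x.
Proof.
have cC x := complete_connected _ (complete_conjugacy_class x).
split=> [[cA maxA]|[x ->]].
  (* The empty graph is vacuously connected, so only maximality constrains an empty [A]; it is
     compared with the class of 1, a connected set containing it. *)
  have [A0|/set0P[x Ax]] := eqVneq A set0.
    by exists 1%g; apply/esym/maxA => //; rewrite A0; exact: sub0set.
  exists x; apply/esym/maxA => //; exact: connected_sub_conjugacy_class.
split=> [//|B CB cB]; apply/seteqP; split=> //.
(* A connected [B] containing the class of [x] contains [x] itself, so it cannot leave that
   class. *)
by apply: connected_sub_conjugacy_class => //; apply/CB/conjugacy_class_refl.
Qed.

End ConjCayley.

Theorem proposition3p2 (G : groupType) :
  symmetric_digraph (cayley_graph (Conj G)) /\
  ([set A : set (cayley_graph (Conj G)) | connected_component A]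
     = [set conjugacy_class x | x in [set: G]] /\
   forall A : set (cayley_graph (Conj G)),
     connected_component A -> complete_digraph (induced A)).
Proof.
split=> [a c /cayley_conj_edgeP ac|].
  exact/cayley_conj_edgeP/conjugacy_class_sym.
split=> [|A /connected_component_conj[x ->]]; last exact: complete_conjugacy_class.
apply/seteqP; split=> A /=.
  by move=> /connected_component_conj[x ->]; exists x.
by move=> [x _ <-]; apply/connected_component_conj; exists x.
Qed.
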